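(* Let $A$ be a finite-dimensional Hopf algebra and $V$ a finite-dimensional $A$-module. For all $x\in A$, $$\mathrm{Tr}_P(x)\,M_{V^*}=\sum_x\operatorname{tr}_V(x_{(2)})\,\mathrm{Tr}_P(x_{(1)}).$$ If $(V^* )^*\cong V$, then $\mathrm{Tr}_P(x)M_V=\sum_x\operatorname{tr}_{V^*}(x_{(2)})\mathrm{Tr}_P(x_{(1)})$; in particular for grouplike $g$, $\mathrm{Tr}_P(g)M_V=\operatorname{tr}_{V^*}(g)\mathrm{Tr}_P(g)$, and if $\Delta(x)=x\otimes y+z\otimes x$ with $y,z\ne0$ then $\mathrm{Tr}_P(x)M_V=\operatorname{tr}_{V^*}(y)\mathrm{Tr}_P(x)+\operatorname{tr}_{V^*}(x)\mathrm{Tr}_P(z)$.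
   Context: $A$ is a finite-dimensional Hopf algebra over an algebraically closed field with coproduct $\Delta(x)=\sum_x x_{(1)}\otimes x_{(2)}$. $S_1,\dots,S_m$ are the non-isomorphic simple $A$-modules and $P_1,\dots,P_m$ their projective covers. $M_W$ is the McKay matrix of a module $W$: $(i,j)$ entry $[S_i\otimes W:S_j]$ (composition multiplicity). $\operatorname{tr}_U(x)$ is the trace of $x$ on $U$, and $\mathrm{Tr}_P(x)=[\operatorname{tr}_{P_1}(x)\ \cdots\ \operatorname{tr}_{P_m}(x)]$ is a row vector. $V^*$ is the dual module. *)

(* Defs.v *)
From HB Require Import structures.
From mathcomp Require Import all_boot all_order all_algebra.
From mathcomp Require Import falgebra.
From mathcomp Require Import mxtens.

Set Implicit Arguments.
Unset Strict Implicit.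
Unset Printing Implicit Defensive.
Import GRing.Theory.
Local Open Scope ring_scope.

(* We fix the basis hb := vbasis {:A} (d := \dim {:A} vectors); an element  *)
(* of A (x) A is encoded by its coordinate matrix 'M[F]_d with respect to    *)
(* the basis (hb_a (x) hb_b).  The coproduct Delta : A -> 'M[F]_d is thus    *)
(* Delta x = \sum_(a,b) (Delta x) a b  hb_a (x) hb_b, and the Sweedler sum   *)
(* "sum_x h(x_(1), x_(2))" for h bilinear is  tsum (Delta x) h  below.       *)

Section Hopf.
Variables (F : fieldType) (A : falgType F).

Definition hdim : nat := \dim (fullv : {vspace A}).
Definition hb : hdim.-tuple A := vbasis fullv.

(* coordinates of the pure tensor u (x) v *)
Definition tcoord (u v : A) : 'M[F]_hdim :=
  \matrix_(a, b) (coord hb a u * coord hb b v).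

(* Sweedler-type sum: for D the coordinates of t = sum_i u_i (x) v_i and h
   bilinear, tsum D h = sum_i h u_i v_i. *)
Definition tsum (T : lmodType F) (D : 'M[F]_hdim) (h : A -> A -> T) : T :=
  \sum_(a < hdim) \sum_(b < hdim) D a b *: h (tnth hb a) (tnth hb b).

Definition is_hopf (Delta : A -> 'M[F]_hdim) (eps : A -> F) (S : A -> A) : Prop :=
  [/\
      [/\ (forall (c : F) (u v : A), Delta (c *: u + v) = c *: Delta u + Delta v),
      (forall (c : F) (u v : A), eps (c *: u + v) = c * eps u + eps v) &
      (forall (c : F) (u v : A), S (c *: u + v) = c *: S u + S v)],
      (* coassociativity: (Delta (x) id) Delta = (id (x) Delta) Delta *)
      (forall (x : A) (a b c : 'I_hdim),
          \sum_(i < hdim) Delta x i c * Delta (tnth hb i) a b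
        = \sum_(j < hdim) Delta x a j * Delta (tnth hb j) b c),
      (forall x : A, tsum (Delta x) (fun u v => eps u *: v) = x
                  /\ tsum (Delta x) (fun u v => eps v *: u) = x),
      [/\ Delta 1 = tcoord 1 1,
          (forall x y : A, Delta (x * y) =
             tsum (Delta x) (fun u v =>
               tsum (Delta y) (fun u' v' => tcoord (u * u') (v * v')))),
          eps 1 = 1 &
          (forall x y : A, eps (x * y) = eps x * eps y)] &
      (forall x : A, tsum (Delta x) (fun u v => S u * v) = eps x *: 1
                  /\ tsum (Delta x) (fun u v => u * S v) = eps x *: 1)].

(* Finite-dimensional (left) A-modules: an n-dimensional module is given by  *)
(* rho : A -> 'M[F]_n, x acting on column vectors v by  rho x *m v.          *)

Definition is_rep n (rho : A -> 'M[F]_n) : Prop :=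
  [/\ (forall (c : F) (u v : A), rho (c *: u + v) = c *: rho u + rho v),
      rho 1 = 1%:M &
      (forall x y : A, rho (x * y) = rho x *m rho y)].

Definition trm n (rho : A -> 'M[F]_n) (x : A) : F := \tr (rho x).

Definition is_hom n1 n2 (rho1 : A -> 'M[F]_n1) (rho2 : A -> 'M[F]_n2)
    (f : 'M[F]_(n2, n1)) : Prop :=
  forall x : A, rho2 x *m f = f *m rho1 x.

Definition mod_iso n1 n2 (rho1 : A -> 'M[F]_n1) (rho2 : A -> 'M[F]_n2) : Prop :=
  exists f : 'M[F]_(n2, n1), [/\ is_hom rho1 rho2 f, row_free f & row_full f].

(* Subspaces of F^n (column vectors) are encoded by square matrices U whose
   row space is the set of transposes of the vectors of the subspace.
   U is a submodule iff it is stable under every rho x. *)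
Definition submod n (rho : A -> 'M[F]_n) (U : 'M[F]_n) : Prop :=
  forall x : A, (U *m (rho x)^T <= U)%MS.

Definition simple_mod n (rho : A -> 'M[F]_n) : Prop :=
  (0 < n)%N /\
  forall U : 'M[F]_n, submod rho U -> \rank U = 0%N \/ \rank U = n.

(* For submodules U <= V of the module rho (dim n), the subquotient V/U is
   isomorphic to the module rhoS (dim s): there is a linear map
   psi : V -> F^s (psi^T restricted to V) which is A-linear on V, vanishes on
   U, is onto, and whose kernel on V is exactly U (dimension count). *)
Definition subquot_iso n s (rho : A -> 'M[F]_n) (U V : 'M[F]_n)
    (rhoS : A -> 'M[F]_s) : Prop :=
  exists psi : 'M[F]_(n, s),
    [/\ (forall x : A, V *m ((rho x)^T *m psi) = V *m (psi *m (rhoS x)^T)),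
        U *m psi = 0,
        \rank (V *m psi) = s &
        \rank V = (\rank U + s)%N].

Definition comp_series n (rho : A -> 'M[F]_n) (r : nat) (U : nat -> 'M[F]_n) : Prop :=
  [/\ \rank (U 0%N) = 0%N,
      \rank (U r) = n,
      (forall k, (k <= r)%N -> submod rho (U k)),
      (forall k, (k < r)%N -> (U k < U k.+1)%MS) &
      (forall k, (k < r)%N -> forall W : 'M[F]_n, submod rho W ->
          ~ ((U k < W)%MS /\ (W < U k.+1)%MS))].

(* composition multiplicity: [W : S] = k iff some composition series of W
   has exactly k factors isomorphic to S (well defined by Jordan-Hoelder) *)
Definition comp_mult n s (rho : A -> 'M[F]_n) (rhoS : A -> 'M[F]_s) (k : nat) : Prop :=
  exists (r : nat) (U : nat -> 'M[F]_n) (lab : 'I_r -> bool),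
    [/\ comp_series rho r U,
        (forall i : 'I_r, lab i <-> subquot_iso rho (U i) (U i.+1) rhoS) &
        k = #|[set i : 'I_r | lab i]|].

Definition projective_mod p (rhoP : A -> 'M[F]_p) : Prop :=
  forall n1 n2 (rho1 : A -> 'M[F]_n1) (rho2 : A -> 'M[F]_n2)
         (g : 'M[F]_(n2, n1)) (f : 'M[F]_(n2, p)),
    is_rep rho1 -> is_rep rho2 ->
    is_hom rho1 rho2 g -> row_free g (* g onto *) ->
    is_hom rhoP rho2 f ->
    exists h : 'M[F]_(n1, p), is_hom rhoP rho1 h /\ g *m h = f.

Definition proj_cover p s (rhoP : A -> 'M[F]_p) (rhoS : A -> 'M[F]_s) : Prop :=
  projective_mod rhoP /\
  exists pi : 'M[F]_(s, p),
    [/\ is_hom rhoP rhoS pi, row_free pi &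
        forall U : 'M[F]_p, submod rhoP U ->
          row_full (U + kermx pi^T)%MS -> row_full U].

Definition tens_rep (Delta : A -> 'M[F]_hdim) n1 n2
    (rho1 : A -> 'M[F]_n1) (rho2 : A -> 'M[F]_n2) : A -> 'M[F]_(n1 * n2) :=
  fun x => tsum (Delta x) (fun u v => tensmx (rho1 u) (rho2 v)).

Definition dual_rep (S : A -> A) n (rho : A -> 'M[F]_n) : A -> 'M[F]_n :=
  fun x => (rho (S x))^T.

Definition TrP m (p : 'I_m -> nat) (rhoP : forall i : 'I_m, A -> 'M[F]_(p i))
    (x : A) : 'rV[F]_m :=
  \row_(i < m) trm (rhoP i) x.

Definition is_McKay (Delta : A -> 'M[F]_hdim) m (s : 'I_m -> nat)
    (rhoS : forall i : 'I_m, A -> 'M[F]_(s i)) n (rhoW : A -> 'M[F]_n)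
    (M : 'M[nat]_m) : Prop :=
  forall i j : 'I_m, comp_mult (tens_rep Delta (rhoS i) rhoW) (rhoS j) (M i j).

End Hopf.

Definition natmx (F : fieldType) m (M : 'M[nat]_m) : 'M[F]_m :=
  map_mx (fun k : nat => k%:R) M.

(* Main.v *)
Require Import Defs.
From HB Require Import structures.
From mathcomp Require Import all_boot all_order all_algebra.
From mathcomp Require Import falgebra.
From mathcomp Require Import mxtens.
From Stdlib Require Import Classical.
Import GRing.Theory.
Local Open Scope ring_scope.

Set Implicit Arguments.
Unset Strict Implicit.
Unset Printing Implicit Defensive.

(** Write V' for the dual of V.  The entry j of the right-hand side of the first
identity is the trace of x on P_j (x) V.  That module is projective, so it is a
direct sum of copies of the P_i, and P_i occurs dim Hom(P_j (x) V, S_i) times.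
The functor - (x) V is left adjoint to - (x) V', hence this dimension equals
dim Hom(P_j, S_i (x) V').  Since Hom(P_j, -) is exact and dim Hom(P_j, S_k) is 1
if j = k and 0 otherwise, it is the multiplicity of S_j in S_i (x) V', an entry
of the McKay matrix. *)

(** * Sweedler calculus *)

(** Multiplicities are given only through some composition series, and no explicit decomposition of
    P_j (x) V is at hand. Both are therefore controlled by dimensions of Hom spaces, which add up
    along exact sequences and direct sums; the decomposition itself is replaced by an induction on
    dimension that splits off one projective cover at a time. Projectivity of P_j (x) V comes from
    the same adjunction, because tensoring with V' preserves surjections. For V' to be a module the
    antipode must reverse products, which is not among the axioms and has to be derived from them.
    Algebraic closure enters through Schur's lemma, which makes the endomorphisms of S_j scalars and
    so gives dim Hom(P_j, S_j) = 1. The identity for M_V is the first one applied to V', whose dual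
    is V up to isomorphism; this is why the general form admits any module isomorphic to the
    dual. *)

Section Sweedler.
Variables (F : fieldType) (A : falgType F).
Implicit Types (T U W : lmodType F) (D E : 'M[F]_(hdim A)).

Definition lin T U (h : T -> U) : Prop :=
  forall c u v, h (c *: u + v) = c *: h u + h v.

Section Lin.
Variables (T U : lmodType F) (h : T -> U).
Hypothesis hl : lin h.

Lemma linD u v : h (u + v) = h u + h v.
Proof. by have := hl 1 u v; rewrite !scale1r. Qed.

Lemma lin0 : h 0 = 0.
Proof. by apply: (addrI (h 0)); rewrite -linD !addr0. Qed.

Lemma linZ c u : h (c *: u) = c *: h u.
Proof. by have := hl c u 0; rewrite !addr0 lin0 addr0. Qed.

Lemma lin_sum (I : Type) (r : seq I) (P : pred I) (f : I -> T) :
  h (\sum_(i <- r | P i) f i) = \sum_(i <- r | P i) h (f i).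
Proof. exact: (big_morph h linD lin0). Qed.

Lemma lin_tsum D (g : A -> A -> T) :
  h (tsum D g) = tsum D (fun u v => h (g u v)).
Proof.
rewrite lin_sum; apply: eq_bigr => a _; rewrite lin_sum.
by apply: eq_bigr => b _; rewrite linZ.
Qed.

End Lin.

Lemma lin_linear T U (h : {linear T -> U}) : lin h.
Proof. by move=> c u v; rewrite linearP. Qed.

Lemma eq_tsum T D (g h : A -> A -> T) :
  (forall u v, g u v = h u v) -> tsum D g = tsum D h.
Proof.
by move=> e; apply: eq_bigr => a _; apply: eq_bigr => b _; rewrite e.
Qed.

Lemma tsum_exchange T D E (g : A -> A -> A -> A -> T) :
  tsum D (fun u v => tsum E (g u v))
  = tsum E (fun u' v' => tsum D (fun u v => g u v u' v')).
Proof.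
have pairE G h : tsum G h = \sum_(p : 'I_(hdim A) * 'I_(hdim A))
    G p.1 p.2 *: h (tnth (hb A) p.1) (tnth (hb A) p.2) :> T.
  by rewrite /tsum pair_bigA.
rewrite !pairE.
under eq_bigr => p _ do rewrite pairE scaler_sumr.
rewrite exchange_big; apply: eq_bigr => q _ /=.
rewrite pairE scaler_sumr; apply: eq_bigr => p _.
by rewrite !scalerA mulrC.
Qed.

Lemma tsum_lin T (h : A -> A -> T) : lin (fun D => tsum D h).
Proof.
move=> c D E; rewrite /tsum scaler_sumr -big_split; apply: eq_bigr => a _ /=.
rewrite scaler_sumr -big_split; apply: eq_bigr => b _ /=.
by rewrite !mxE scalerDl scalerA.
Qed.

Lemma hb_coord x : x = \sum_(a < hdim A) coord (hb A) a x *: tnth (hb A) a.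
Proof.
rewrite {1}(coord_vbasis (memvf x)).
by apply: eq_bigr => a _; rewrite (tnth_nth 0).
Qed.

(** Bilinearity reassembles the basis expansions of [u] and [v]. Coproducts given as pure tensors,
    such as those of 1 and of grouplike elements, can thus be evaluated without coordinates. *)
Lemma tsum_tcoord T (h : A -> A -> T) u v :
  (forall w, lin (h^~ w)) -> (forall w, lin (h w)) -> tsum (tcoord u v) h = h u v.
Proof.
move=> h1 h2; rewrite [in RHS](hb_coord u) (lin_sum (h1 v)).
apply: eq_bigr => a _; rewrite (linZ (h1 v)) [in RHS](hb_coord v).
rewrite (lin_sum (h2 _)) scaler_sumr; apply: eq_bigr => b _.
by rewrite (linZ (h2 _)) scalerA mxE.
Qed.

Lemma mulmx_tsuml D m n p (g : A -> A -> 'M[F]_(m, n)) (M : 'M[F]_(n, p)) :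
  tsum D g *m M = tsum D (fun u v => g u v *m M).
Proof. exact: (lin_tsum (lin_linear (mulmxr M))). Qed.

Lemma mulmx_tsumr D m n p (g : A -> A -> 'M[F]_(n, p)) (M : 'M[F]_(m, n)) :
  M *m tsum D g = tsum D (fun u v => M *m g u v).
Proof. exact: (lin_tsum (lin_linear (mulmx M))). Qed.

End Sweedler.

(** * Hopf axioms under linear maps, the antipode, dual and tensor modules *)

Section HopfAlgebra.
Variables (F : fieldType) (A : falgType F).
Variables (Delta : A -> 'M[F]_(hdim A)) (eps : A -> F) (S : A -> A).
Hypothesis hH : is_hopf Delta eps S.

Lemma Delta_lin : lin Delta. Proof. by case: hH => [[]]. Qed.
Lemma antipode_lin : lin S. Proof. by case: hH => [[]]. Qed.

Lemma tsum_Delta_lin (T : lmodType F) (h : A -> A -> T) :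
  lin (fun x => tsum (Delta x) h).
Proof. by move=> c u v; rewrite Delta_lin tsum_lin. Qed.

(** Both sides evaluate [h] at triples of basis vectors only, so the axiom, an identity between
    structure constants, gives the equality coefficient by coefficient for an arbitrary function
    [h]. *)
Lemma coassoc (T : lmodType F) (h : A -> A -> A -> T) x :
  tsum (Delta x) (fun u w => tsum (Delta u) (fun a b => h a b w))
  = tsum (Delta x) (fun a w => tsum (Delta w) (fun b c => h a b c)).
Proof.
have ca := let: And5 _ ca _ _ _ := hH in ca.
transitivity (\sum_a \sum_b \sum_c
   (\sum_i Delta x i c * Delta (tnth (hb A) i) a b)
    *: h (tnth (hb A) a) (tnth (hb A) b) (tnth (hb A) c)).
  rewrite /tsum.
  under eq_bigr => i _ do under eq_bigr => c _ do
    (rewrite scaler_sumr; under eq_bigr => a _ do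
      (rewrite scaler_sumr; under eq_bigr => b _ do rewrite scalerA)).
  rewrite exchange_big /=.
  under eq_bigr => c _ do (rewrite exchange_big /=;
     under eq_bigr => a _ do rewrite exchange_big /=).
  rewrite exchange_big; apply: eq_bigr => a _ /=.
  rewrite exchange_big; apply: eq_bigr => b _ /=.
  by apply: eq_bigr => c _; rewrite scaler_suml.
apply: eq_bigr => a _ /=.
under eq_bigr => b _ do under eq_bigr => c _ do rewrite ca scaler_suml.
under [RHS]eq_bigr => j _ do (rewrite scaler_sumr; under eq_bigr => b _ do
   (rewrite scaler_sumr; under eq_bigr => c _ do rewrite scalerA)).
rewrite [RHS]exchange_big; apply: eq_bigr => b _ /=.
by rewrite [RHS]exchange_big.
Qed.

Lemma counitl (T : lmodType F) (h : A -> T) x :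
  lin h -> tsum (Delta x) (fun u v => eps u *: h v) = h x.
Proof.
move=> hl; have [cu _] := (let: And5 _ _ cu _ _ := hH in cu) x.
rewrite -[in RHS]cu (lin_tsum hl); apply: eq_tsum => u v.
by rewrite (linZ hl).
Qed.

Lemma counitr (T : lmodType F) (h : A -> T) x :
  lin h -> tsum (Delta x) (fun u v => eps v *: h u) = h x.
Proof.
move=> hl; have [_ cu] := (let: And5 _ _ cu _ _ := hH in cu) x.
rewrite -[in RHS]cu (lin_tsum hl); apply: eq_tsum => u v.
by rewrite (linZ hl).
Qed.

Lemma antipodel (T : lmodType F) (h : A -> T) x :
  lin h -> tsum (Delta x) (fun u v => h (S u * v)) = eps x *: h 1.
Proof.
move=> hl; have [an _] := (let: And5 _ _ _ _ an := hH in an) x.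
by rewrite -(linZ hl) -an (lin_tsum hl).
Qed.

Lemma antipoder (T : lmodType F) (h : A -> T) x :
  lin h -> tsum (Delta x) (fun u v => h (u * S v)) = eps x *: h 1.
Proof.
move=> hl; have [_ an] := (let: And5 _ _ _ _ an := hH in an) x.
by rewrite -(linZ hl) -an (lin_tsum hl).
Qed.

Lemma tsum_DeltaM (T : lmodType F) (h : A -> A -> T) x y :
  (forall w, lin (h^~ w)) -> (forall w, lin (h w)) ->
  tsum (Delta (x * y)) h = tsum (Delta x) (fun u v =>
    tsum (Delta y) (fun u' v' => h (u * u') (v * v'))).
Proof.
move=> h1 h2; have [_ DM _ _] := (let: And5 _ _ _ bi _ := hH in bi).
rewrite DM (lin_tsum (tsum_lin h)); apply: eq_tsum => u v.
rewrite (lin_tsum (tsum_lin h)); apply: eq_tsum => u' v'.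
exact: tsum_tcoord.
Qed.

Lemma tsum_Delta1 (T : lmodType F) (h : A -> A -> T) :
  (forall w, lin (h^~ w)) -> (forall w, lin (h w)) ->
  tsum (Delta 1) h = h 1 1.
Proof.
move=> h1 h2; have [-> _ _ _] := (let: And5 _ _ _ bi _ := hH in bi).
exact: tsum_tcoord.
Qed.

Let mull_lin (a : A) : lin ( *%R a).
Proof. by move=> c u v; rewrite mulrDr scalerAr. Qed.

Let mulr_lin (a : A) : lin ( *%R^~ a).
Proof. by move=> c u v; rewrite mulrDl scalerAl. Qed.

Lemma antipode1 : S 1 = 1.
Proof.
have [_ _ e1 _] := (let: And5 _ _ _ bi _ := hH in bi).
have := @antipodel _ id 1 (fun _ _ _ => erefl).
rewrite tsum_Delta1 => [|w c u v|w c u v].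
- by rewrite mulr1 e1 scale1r.
- by rewrite antipode_lin mulr_lin.
by rewrite mull_lin.
Qed.

(* Both sides are convolution inverses of the product A (x) A -> A: expand
   S(x1 y1) x2 y2 S(y3) S(x3) in two ways. *)
Lemma antipodeM x y : S (x * y) = S y * S x.
Proof.
have [_ _ e1 eM] := (let: And5 _ _ _ bi _ := hH in bi).
have SlinL (a : A) : lin (fun w => S (w * a)).
  by move=> c u v; rewrite mulr_lin antipode_lin.
have SlinR (a : A) : lin (fun w => S (a * w)).
  by move=> c u v; rewrite mull_lin antipode_lin.
pose T := tsum (Delta x) (fun u v => tsum (Delta u) (fun a b =>
   tsum (Delta y) (fun u' v' => tsum (Delta u') (fun a' b' =>
     S (a * a') * (b * b') * (S v' * S v))))).
transitivity T.
  rewrite /T coassoc.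
  transitivity (tsum (Delta x) (fun a w => eps w *: S (a * y))).
    by rewrite counitr.
  apply: eq_tsum => a w; rewrite -[S (a * y)]mulr1.
  rewrite -(antipoder w (mull_lin (S (a * y)))).
  apply: eq_tsum => b v; rewrite coassoc.
  rewrite -(counitr y (h := fun a' => S (a * a') * (b * S v))); last first.
    by move=> c u' v'; rewrite SlinR mulr_lin.
  apply: eq_tsum => a' w'.
  have hl : lin (fun z => S (a * a') * (b * (z * S v))).
    by move=> c u' v'; rewrite mulr_lin !mull_lin.
  have := antipoder w' hl; rewrite mul1r => <-.
  by apply: eq_tsum => b' v'; rewrite !mulrA.
rewrite /T.
(* By multiplicativity of [Delta], the inner sum is the antipode sum of the single element [u * u'],
   hence the scalar eps(u) eps(u'). *)
transitivity (tsum (Delta x) (fun u v => tsum (Delta y) (fun u' v' =>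
   (eps u * eps u') *: (S v' * S v)))).
  apply: eq_tsum => u v; rewrite tsum_exchange; apply: eq_tsum => u' v'.
  have hl : lin (fun z => z * (S v' * S v)) by apply: mulr_lin.
  have := antipodel (u * u') hl; rewrite mul1r eM => <-.
  rewrite tsum_DeltaM // => w c a b.
    by rewrite antipode_lin mulr_lin hl.
  by rewrite mull_lin hl.
have hl : lin (fun z => S y * S z).
  by move=> c u v; rewrite antipode_lin mull_lin.
rewrite -(counitl x hl); apply: eq_tsum => u v.
have hl' : lin (fun z => S z * S v).
  by move=> c u' v'; rewrite antipode_lin mulr_lin.
rewrite -(counitl y hl').
rewrite (lin_tsum (h := *:%R (eps u))); last exact: lin_linear.
by apply: eq_tsum => u' v'; rewrite scalerA.
Qed.

(** Transposition and [S] both reverse products, so the two reversals cancel. *)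
Lemma dual_rep_is_rep n (rho : A -> 'M[F]_n) :
  is_rep rho -> is_rep (dual_rep S rho).
Proof.
case=> rl r1 rM; split=> [c u v||x y]; rewrite /dual_rep.
- by rewrite antipode_lin rl linearP.
- by rewrite antipode1 r1 trmx1.
by rewrite antipodeM rM trmx_mul.
Qed.

Lemma tensmx_linl m n p q (B : 'M[F]_(p, q)) : lin (fun M : 'M[F]_(m, n) => tensmx M B).
Proof. by move=> c u v; apply/matrixP=> i j; rewrite !mxE mulrDl mulrA. Qed.

Lemma tensmx_linr m n p q (B : 'M[F]_(p, q)) : lin (fun M : 'M[F]_(m, n) => tensmx B M).
Proof. by move=> c u v; apply/matrixP=> i j; rewrite !mxE mulrDr mulrCA. Qed.

Lemma tensmx11 m n : tensmx 1%:M 1%:M = 1%:M :> 'M[F]_(m * n).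
Proof.
apply/matrixP=> i j; case: (mxtens_indexP i) => a b.
case: (mxtens_indexP j) => c d; rewrite tensmxE !mxE.
rewrite (can_eq (@mxtens_indexK _ _)) xpair_eqE.
by case: eqP; case: eqP; rewrite ?mulr0 ?mulr1.
Qed.

Lemma mxtrace_tens m n (B : 'M[F]_m) (C : 'M[F]_n) : \tr (tensmx B C) = \tr B * \tr C.
Proof. by rewrite /mxtrace mulr_sum; apply: eq_bigr => i _; rewrite mxE. Qed.

Lemma tens_rep_is_rep n1 n2 (rho1 : A -> 'M[F]_n1) (rho2 : A -> 'M[F]_n2) :
  is_rep rho1 -> is_rep rho2 -> is_rep (tens_rep Delta rho1 rho2).
Proof.
move=> [l1 u1 m1] [l2 u2 m2].
have L1 w : lin (fun u => tensmx (rho1 u) (rho2 w)).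
  by move=> c u v; rewrite l1 tensmx_linl.
have L2 w : lin (fun v => tensmx (rho1 w) (rho2 v)).
  by move=> c u v; rewrite l2 tensmx_linr.
split=> [||x y]; first exact: tsum_Delta_lin.
  by rewrite /tens_rep tsum_Delta1 // u1 u2 tensmx11.
rewrite /tens_rep tsum_DeltaM // mulmx_tsuml; apply: eq_tsum => u v /=.
by rewrite mulmx_tsumr; apply: eq_tsum => u' v'; rewrite tensmx_mul m1 m2.
Qed.

End HopfAlgebra.

(** * Modules and spaces of homomorphisms *)

(** Rank-nullity in membership form, for comparing Hom spaces: a short exact sequence gives
    additivity, and [K] = 0 gives equality of dimensions along a bijection. *)
Lemma dimv_exact (F : fieldType) (aT rT : vectType F) (h : {linear aT -> rT})
    (K U : {vspace aT}) (V : {vspace rT}) :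
  (forall f, f \in U -> h f \in V) ->
  (forall g, g \in V -> exists2 f, f \in U & h f = g) ->
  (forall f, f \in K <-> f \in U /\ h f = 0) ->
  \dim U = (\dim K + \dim V)%N.
Proof.
move=> hUV hsurj hK; rewrite -(limg_ker_dim (linfun h) U).
congr addn; congr dimv; apply/vspaceP => f.
  rewrite memv_cap memv_ker lfunE /=.
  by apply/andP/idP => [[fU /eqP f0]|/hK[fU ->]]; [apply/hK | rewrite eqxx].
apply/memv_imgP/idP => [[u uU ->]|/hsurj[u uU <-]].
  by rewrite lfunE; apply: hUV.
by exists u; rewrite ?lfunE.
Qed.

Section Modules.
Variables (F : fieldType) (A : falgType F).

Lemma is_hom1 n (r : A -> 'M[F]_n) : is_hom r r 1%:M.
Proof. by move=> x; rewrite mulmx1 mul1mx. Qed.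

Lemma is_hom_comp n1 n2 n3 (r1 : A -> 'M[F]_n1) (r2 : A -> 'M[F]_n2)
    (r3 : A -> 'M[F]_n3) f g :
  is_hom r1 r2 f -> is_hom r2 r3 g -> is_hom r1 r3 (g *m f).
Proof. by move=> hf hg x; rewrite mulmxA hg -mulmxA hf mulmxA. Qed.

Lemma is_hom_tr n1 n2 (r1 : A -> 'M[F]_n1) (r2 : A -> 'M[F]_n2) f x :
  is_hom r1 r2 f -> (r1 x)^T *m f^T = f^T *m (r2 x)^T.
Proof. by move=> hf; rewrite -!trmx_mul hf. Qed.

Lemma row_free_trmx m n (f : 'M[F]_(m, n)) : row_free f^T = row_full f.
Proof. by rewrite /row_free /row_full mxrank_tr. Qed.

Lemma row_full_trmx m n (f : 'M[F]_(m, n)) : row_full f^T = row_free f.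
Proof. by rewrite /row_free /row_full mxrank_tr. Qed.

(** An injective intertwiner can be cancelled on the left, which pulls the module laws back; the
    surjective counterpart pushes them forward. A sub or quotient action then only needs its
    intertwiner. *)
Lemma is_rep_mono n1 n2 (r1 : A -> 'M[F]_n1) (r2 : A -> 'M[F]_n2) i :
  is_rep r2 -> is_hom r1 r2 i -> row_full i -> is_rep r1.
Proof.
move=> [l u m] hi fi; split=> [c a b||x y]; apply: (row_full_inj fi).
- by rewrite -hi l mulmxDr mulmxDl -scalemxAl -scalemxAr !hi.
- by rewrite -hi u mul1mx mulmx1.
by rewrite mulmxA -!hi m -!mulmxA -hi.
Qed.

Lemma is_rep_epi n1 n2 (r1 : A -> 'M[F]_n1) (r2 : A -> 'M[F]_n2) q :
  is_rep r1 -> is_hom r1 r2 q -> row_free q -> is_rep r2.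
Proof.
move=> [l u m] hq fq; split=> [c a b||x y]; apply: (row_free_inj fq).
- by rewrite hq l mulmxDr mulmxDl -scalemxAl -scalemxAr !hq.
- by rewrite hq u mul1mx mulmx1.
by rewrite -mulmxA !hq m mulmxA -hq mulmxA.
Qed.

Lemma sub_rep n (rho : A -> 'M[F]_n) U :
  is_rep rho -> submod rho U ->
  exists r (rhoU : A -> 'M[F]_r) (i : 'M[F]_(n, r)),
    [/\ is_rep rhoU, is_hom rhoU rho i, row_full i & (i^T :=: U)%MS].
Proof.
move=> hr hU; pose B := row_base U.
pose rhoU x := (B *m (rho x)^T *m pinvmx B)^T.
have hi : is_hom rhoU rho B^T.
  move=> x; apply: trmx_inj; rewrite !trmx_mul !trmxK mulmxKpV //.
  by rewrite (eqmxMr _ (eq_row_base U)) eq_row_base; apply: hU.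
have fi : row_full B^T by rewrite row_full_trmx row_base_free.
exists (\rank U), rhoU, B^T; split=> //; last by rewrite trmxK; apply: eq_row_base.
exact: is_rep_mono hr hi fi.
Qed.

Lemma quot_rep n (rho : A -> 'M[F]_n) U :
  is_rep rho -> submod rho U ->
  exists r (rhoQ : A -> 'M[F]_r) (q : 'M[F]_(r, n)),
    [/\ is_rep rhoQ, is_hom rho rhoQ q, row_free q & (kermx q^T :=: U)%MS].
Proof.
move=> hr hU.
have [c [C [fC kC]]] : exists c (C : 'M[F]_(n, c)), row_full C /\
    forall k (v : 'M_(k, n)), (v *m C == 0) = (v <= U)%MS.
  exists _, (col_base (cokermx U)); split=> [|k v]; first exact: col_base_full.
  rewrite submxE -[in RHS](mulmx_base (cokermx U)) mulmxA.
  by rewrite [RHS]mulmx_free_eq0 ?row_base_free.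
have [D DC] := row_fullP fC.
pose rhoQ x := (D *m (rho x)^T *m C)^T.
have hq : is_hom rho rhoQ C^T.
  move=> x; apply: trmx_inj; rewrite !trmx_mul !trmxK; apply/eqP.
  (* The equation amounts to (C D - 1) (rho x)^T <= U. Since D C = 1, the rows of C D - 1 are killed
     by [C], so they lie in the stable subspace [U]. *)
  rewrite !mulmxA -subr_eq0 -mulmxBl kC -[X in _ - X]mul1mx -mulmxBl.
  apply: submx_trans (hU x); apply: submxMr.
  by rewrite -kC mulmxBl -mulmxA DC mul1mx mulmx1 subrr.
have fq : row_free C^T by rewrite row_free_trmx.
exists _, rhoQ, C^T; split=> //; first exact: is_rep_epi hr hq fq.
rewrite trmxK; apply/eqmxP; rewrite -kC mulmx_ker eqxx /=.
by apply/sub_kermxP/eqP; rewrite kC.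
Qed.

Lemma submod_ker n1 n2 (r1 : A -> 'M[F]_n1) (r2 : A -> 'M[F]_n2) f :
  is_hom r1 r2 f -> submod r1 (kermx f^T).
Proof.
move=> hf x; apply/sub_kermxP.
by rewrite -mulmxA (is_hom_tr x hf) mulmxA mulmx_ker mul0mx.
Qed.

Lemma submod_img n1 n2 (r1 : A -> 'M[F]_n1) (r2 : A -> 'M[F]_n2) f U :
  is_hom r1 r2 f -> submod r1 U -> submod r2 <<U *m f^T>>%MS.
Proof.
move=> hf hU x; rewrite (eqmxMr _ (genmxE _)) genmxE.
by rewrite -mulmxA -(is_hom_tr x hf) mulmxA submxMr.
Qed.

Lemma submod1 n (rho : A -> 'M[F]_n) : submod rho 1%:M.
Proof. by move=> x; apply: submx1. Qed.

(** V/U is realised as the image of [V] inside the quotient by [U]; [psi] is the quotient map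
    written in coordinates of that image, which is meaningful on [V]. *)
Lemma subquot_exists n (rho : A -> 'M[F]_n) U V :
  is_rep rho -> submod rho U -> submod rho V -> (U <= V)%MS ->
  exists r (rhoQ : A -> 'M[F]_r), is_rep rhoQ /\ subquot_iso rho U V rhoQ.
Proof.
move=> hr hU hV sUV; have [w [rhoW [q [hrW hq fq kq]]]] := quot_rep hr hU.
have [r [rhoQ [i [hrQ hi fi ei]]]] := sub_rep hrW (submod_img hq hV).
have {}ei : (i^T :=: V *m q^T)%MS := eqmx_trans ei (genmxE _).
have fiT : row_free i^T by rewrite row_free_trmx.
have [psi psiE U0] : exists2 psi, (forall k (v : 'M_(k, n)), (v <= V)%MS ->
    v *m psi *m i^T = v *m q^T) & U *m psi = 0.
  exists (q^T *m pinvmx i^T) => [k v vV|].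
    by rewrite mulmxA mulmxKpV // ei submxMr.
  have : (U <= kermx q^T)%MS by rewrite kq.
  by move/sub_kermxP => U0; rewrite mulmxA U0 mul0mx.
exists r, rhoQ; split=> //; exists psi; split=> // [x||].
- apply: (row_free_inj fiT); transitivity (V *m q^T *m (rhoW x)^T).
    by rewrite mulmxA psiE ?hV // -!mulmxA (is_hom_tr x hq).
  by rewrite -(psiE _ V) // -!mulmxA (is_hom_tr x hi).
- rewrite -(mxrankMfree _ fiT) psiE // -ei.
  by rewrite mxrank_tr; apply/eqP.
rewrite -(mxrank_mul_ker V q^T) -ei mxrank_tr addnC (eqP fi).
by rewrite (cap_eqmx (eqmx_refl V) kq) (capmx_idPr sUV).
Qed.

Lemma subquot_ker n s (U V : 'M[F]_n) (psi : 'M[F]_(n, s)) :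
  (U <= V)%MS -> U *m psi = 0 -> \rank (V *m psi) = s ->
  \rank V = (\rank U + s)%N -> (V :&: kermx psi :=: U)%MS.
Proof.
move=> sUV U0 rs rV.
have sU : (U <= V :&: kermx psi)%MS.
  by rewrite sub_capmx sUV; apply/sub_kermxP.
apply: eqmx_sym; apply/eqmxP; rewrite sU /=.
rewrite -(geq_leqif (mxrank_leqif_sup sU)).
by rewrite -(leq_add2l (\rank (V *m psi))) mxrank_mul_ker rV rs addnC.
Qed.

(** A submodule [X] of the factor pulls back to a submodule [W] between [U] and [V]. As nothing lies
    strictly between, W = U and X = 0, or W = V and [X] is everything. *)
Lemma subquot_simple n s (rho : A -> 'M[F]_n) U V (rhoQ : A -> 'M[F]_s) :
  (U < V)%MS -> submod rho V ->
  (forall W : 'M[F]_n, submod rho W -> ~ ((U < W)%MS /\ (W < V)%MS)) ->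
  subquot_iso rho U V rhoQ -> simple_mod rhoQ.
Proof.
move=> ltUV hV hmax [psi [hpsi U0 rs rV]].
split.
  have := ltmxErank U V; rewrite ltUV => /esym/andP[_].
  by rewrite rV -[X in (X < _)%N]addn0 ltn_add2l.
move=> X hX; pose W := (V :&: kermx (psi *m cokermx X))%MS.
have memW k (v : 'M_(k, n)) : (v <= W)%MS = (v <= V)%MS && (v *m psi <= X)%MS.
  rewrite sub_capmx [(_ <= X)%MS]submxE; congr andb.
  by rewrite -mulmxA; apply/sub_kermxP/eqP.
have hW : submod rho W.
  move=> x; rewrite memW.
  have := submx_refl W; rewrite memW => /andP[/submxP[D eD] WX].
  rewrite eD -!mulmxA hpsi (submx_trans (submxMl _ _) (hV x)) /=.
  rewrite !mulmxA -eD.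
  exact: submx_trans (submxMr _ WX) (hX x).
have sUV := ltmxW ltUV.
have sUW : (U <= W)%MS by rewrite memW sUV U0 sub0mx.
have sWV : (W <= V)%MS by rewrite capmxSl.
case: (boolP (W <= U)%MS) => [sWU|nWU]; last first.
  right; have := hmax W hW; rewrite !ltmxE sUW sWV nWU /=.
  case: (boolP (V <= W)%MS) => [|_]; last by case.
  rewrite memW submx_refl /= => /mxrankS; rewrite rs => sX _.
  by apply/eqP; rewrite eqn_leq rank_leq_row.
left; have : (X <= V *m psi)%MS.
  by apply: submx_full; rewrite /row_full rs.
case/submxP=> D eD; apply/eqP; rewrite mxrank_eq0 eD mulmxA; apply/eqP.
have : (D *m V <= U)%MS.
  by apply: submx_trans sWU; rewrite memW submxMl -mulmxA -eD submx_refl.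
by case/submxP=> E ->; rewrite -mulmxA U0 mulmx0.
Qed.

(** Imposing commutation on basis elements makes Hom a finite intersection of kernels, hence a
    [{vspace _}] with a dimension. *)
Definition homv n1 n2 (r1 : A -> 'M[F]_n1) (r2 : A -> 'M[F]_n2) :
    {vspace 'M[F]_(n2, n1)} :=
  (\bigcap_(a < hdim A) lker (linfun
     (mulmx (r2 (tnth (hb A) a)) \- mulmxr (r1 (tnth (hb A) a)))))%VS.

Lemma homvP n1 n2 (r1 : A -> 'M[F]_n1) (r2 : A -> 'M[F]_n2) f :
  is_rep r1 -> is_rep r2 -> reflect (is_hom r1 r2 f) (f \in homv r1 r2).
Proof.
move=> [l1 _ _] [l2 _ _].
have E a : (f \in lker (linfun (mulmx (r2 a) \- mulmxr (r1 a)))) =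
    (r2 a *m f == f *m r1 a).
  by rewrite memv_ker lfunE /= subr_eq0.
apply: (iffP idP) => [|hf].
  rewrite memvE => /subv_bigcapP hf x.
  rewrite [x]hb_coord (lin_sum l1) (lin_sum l2) mulmx_suml mulmx_sumr.
  apply: eq_bigr => a _; rewrite (linZ l1) (linZ l2).
  rewrite -scalemxAl -scalemxAr; congr (_ *: _); apply/eqP.
  by rewrite -E memvE; apply: hf.
by rewrite memvE; apply/subv_bigcapP => a _; rewrite -memvE E hf.
Qed.

(** Plays the role of Hom(r1, U). Keeping it inside Hom(r1, r2) lets all terms of a composition
    series be compared in one ambient space. *)
Definition homv_in n1 n2 (r1 : A -> 'M[F]_n1) (r2 : A -> 'M[F]_n2) (U : 'M[F]_n2) :
    {vspace 'M[F]_(n2, n1)} :=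
  (homv r1 r2 :&: lker (linfun (mulmxr (cokermx U) \o trmx)))%VS.

Lemma mem_homv_in n1 n2 (r1 : A -> 'M[F]_n1) (r2 : A -> 'M[F]_n2) U f :
  (f \in homv_in r1 r2 U) = (f \in homv r1 r2) && (f^T <= U)%MS.
Proof. by rewrite memv_cap memv_ker lfunE submxE. Qed.

(** Exactness of 0 -> Hom(P, U) -> Hom(P, V) -> Hom(P, V/U) -> 0, where projectivity gives
    surjectivity on the right. *)
Lemma dim_homv_in_step p n s (rhoP : A -> 'M[F]_p) (rho : A -> 'M[F]_n)
    (rhoQ : A -> 'M[F]_s) U V :
  is_rep rhoP -> projective_mod rhoP -> is_rep rho -> is_rep rhoQ ->
  submod rho V -> (U <= V)%MS -> subquot_iso rho U V rhoQ ->
  \dim (homv_in rhoP rho V) = (\dim (homv_in rhoP rho U) + \dim (homv rhoP rhoQ))%N.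
Proof.
move=> hP pP hr hQ hV sUV [psi [hpsi U0 rs rV]].
have psiV k (v : 'M_(k, n)) x : (v <= V)%MS ->
    v *m ((rho x)^T *m psi) = v *m (psi *m (rhoQ x)^T).
  by case/submxP=> D ->; rewrite -!mulmxA hpsi.
apply: (dimv_exact (h := mulmx psi^T)) => [f|g|f].
- rewrite mem_homv_in => /andP[/(homvP _ hP hr) hf fV]; apply/homvP => // x /=.
  apply: trmx_inj; rewrite !trmx_mul !trmxK -mulmxA -psiV // !mulmxA.
  by rewrite (is_hom_tr x hf).
- move/(homvP _ hP hQ) => hg.
  (* The lifting property speaks of modules, not of subspaces, so [V] is replaced by a
     representation with an inclusion [i]. *)
  have [r [rhoV [i [hrV hi fi ei]]]] := sub_rep hr hV.
  have hpi : is_hom rhoV rhoQ (psi^T *m i).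
    move=> x; apply: trmx_inj; rewrite !trmx_mul !trmxK -mulmxA -psiV ?ei //.
    by rewrite !mulmxA (is_hom_tr x hi).
  have fpi : row_free (psi^T *m i).
    by rewrite -row_full_trmx trmx_mul trmxK /row_full (eqmxMr psi ei) rs.
  have [h [hh eh]] := pP _ _ _ _ _ _ hrV hQ hpi fpi hg.
  exists (i *m h); last by rewrite /= mulmxA.
  rewrite mem_homv_in trmx_mul -ei submxMl andbT.
  by apply/homvP => //; apply: is_hom_comp hh hi.
rewrite !mem_homv_in -(subquot_ker sUV U0 rs rV) sub_capmx.
split=> [/and3P[-> -> /sub_kermxP f0]|[/andP[-> ->] /= f0]].
  by split=> //=; apply: trmx_inj; rewrite trmx_mul trmxK f0 trmx0.
by apply/sub_kermxP; rewrite -[f^T *m psi]trmxK trmx_mul trmxK f0 trmx0.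
Qed.

End Modules.

(** * Simple and projective modules *)

Section Simple.
Variables (F : fieldType) (A : falgType F).

Lemma simple_epi n1 n2 (r1 : A -> 'M[F]_n1) (r2 : A -> 'M[F]_n2) f :
  is_hom r1 r2 f -> simple_mod r2 -> f != 0 -> row_free f.
Proof.
move=> hf [_ s2] f0; have := s2 _ (submod_img hf (submod1 r1)).
rewrite mul1mx mxrank_gen mxrank_tr => -[/eqP|/eqP//].
by rewrite mxrank_eq0 (negPf f0).
Qed.

Lemma simple_mono n1 n2 (r1 : A -> 'M[F]_n1) (r2 : A -> 'M[F]_n2) f :
  is_hom r1 r2 f -> simple_mod r1 -> f != 0 -> row_full f.
Proof.
move=> hf [_ s1] f0; have := s1 _ (submod_ker hf).
rewrite -row_free_trmx -kermx_eq0 => -[/eqP|/eqP]; first by rewrite mxrank_eq0.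
case/row_fullP=> B kB; case/negP: f0.
by rewrite -trmx_eq0 -[f^T]mul1mx -kB -mulmxA mulmx_ker mulmx0.
Qed.

Lemma row_full_add_ker m p s (pi : 'M[F]_(s, p)) (U : 'M[F]_(m, p)) :
  row_full (U *m pi^T) -> row_full (U + kermx pi^T)%MS.
Proof.
move=> /(submx_full pi^T)/submxP[D eD]; rewrite -sub1mx.
rewrite -[1%:M](subrK (D *m U)) addrC addmx_sub_adds ?submxMl //.
by apply/sub_kermxP; rewrite mulmxBl mul1mx -mulmxA -eD subrr.
Qed.

(** The point is that ker f lies in ker pi. Otherwise ker f maps onto the simple module S, so ker f
    + ker pi is all of P, and superfluity of ker pi makes ker f all of P, against f != 0. *)
Lemma proj_cover_factor p s t (rhoP : A -> 'M[F]_p) (rhoS : A -> 'M[F]_s)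
    (rhoT : A -> 'M[F]_t) (pi : 'M[F]_(s, p)) f :
  is_hom rhoP rhoS pi -> simple_mod rhoS ->
  (forall U : 'M[F]_p, submod rhoP U -> row_full (U + kermx pi^T)%MS -> row_full U) ->
  simple_mod rhoT -> is_hom rhoP rhoT f -> f != 0 ->
  exists2 g, is_hom rhoT rhoS g & pi = g *m f.
Proof.
move=> hpi [_ sS] ess sT hf f0; have ff := simple_epi hf sT f0.
have kpi : kermx f^T *m pi^T = 0.
  have := sS _ (submod_img hpi (submod_ker hf)); rewrite mxrank_gen.
  move=> -[/eqP|/eqP/row_full_add_ker]; first by rewrite mxrank_eq0 => /eqP.
  move=> /(ess _ (submod_ker hf))/row_fullP[B kB]; case/negP: f0.
  by rewrite -trmx_eq0 -[f^T]mul1mx -kB -mulmxA mulmx_ker mulmx0.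
have [B fB] := row_freeP ff; have piE : pi = pi *m B *m f.
  have /submxP[C eC] : (1%:M - (B *m f)^T <= kermx f^T)%MS.
    apply/sub_kermxP; rewrite mulmxBl mul1mx -trmx_mul mulmxA fB mul1mx.
    by rewrite subrr.
  apply: trmx_inj; apply/eqP; rewrite -mulmxA [X in _ == X]trmx_mul -subr_eq0.
  by rewrite -[X in X - _]mul1mx -mulmxBl eC -mulmxA kpi mulmx0.
exists (pi *m B) => // x; apply: (row_free_inj ff).
by rewrite -mulmxA -piE hpi -mulmxA hf mulmxA -piE.
Qed.

Lemma subquot_iso_trans n s t (rho : A -> 'M[F]_n) U V (rhoQ : A -> 'M[F]_s)
    (rhoT : A -> 'M[F]_t) :
  subquot_iso rho U V rhoQ -> mod_iso rhoQ rhoT -> subquot_iso rho U V rhoT.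
Proof.
move=> [psi [hpsi U0 rs rV]] [f [hf fr fl]]; exists (psi *m f^T).
have st : s = t by rewrite -(eqP fr) (eqP fl).
split=> [x|||].
- by rewrite !mulmxA -[_ *m psi]mulmxA hpsi -!mulmxA (is_hom_tr x hf).
- by rewrite mulmxA U0 mul0mx.
- by rewrite mulmxA mxrankMfree ?row_free_trmx // rs.
by rewrite rV st.
Qed.

(** A nonzero module that is not simple has a proper nonzero submodule, and the quotient by it is
    again nonzero but of smaller dimension. *)
Lemma simple_quot n (rho : A -> 'M[F]_n) : is_rep rho -> (0 < n)%N ->
  exists t (rhoT : A -> 'M[F]_t) (q : 'M[F]_(t, n)),
    [/\ is_rep rhoT, simple_mod rhoT, is_hom rho rhoT q & row_free q].
Proof.
elim/ltn_ind: n => n IH in rho *; move=> hr n0.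
have [sr|nsr] := classic (simple_mod rho).
  exists n, rho, 1%:M; split=> //; first exact: is_hom1.
  by rewrite /row_free mxrank1.
have [U [hU U0 Un]] : exists U, [/\ submod rho U, \rank U != 0%N & \rank U != n].
  apply: NNPP => nU; apply: nsr; split=> // U hU.
  have [|U0] := eqVneq (\rank U) 0%N; first by left.
  have [|Un] := eqVneq (\rank U) n; first by right.
  by case: nU; exists U.
have [r [rhoQ [q [hQ hq fq kq]]]] := quot_rep hr hU.
have rU : \rank U = (n - r)%N by rewrite -kq mxrank_ker mxrank_tr (eqP fq).
have lrn : (r <= n)%N by rewrite -(eqP fq) rank_leq_col.
have r0 : (0 < r)%N by case: (posnP r) Un => // r0; rewrite rU r0 subn0 eqxx.
have rn : (r < n)%N by rewrite -subn_gt0 -rU lt0n.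
have [t [rhoT [q' [hT sT hq' fq']]]] := IH r rn rhoQ hQ r0.
exists t, rhoT, (q' *m q); split=> //; first exact: is_hom_comp hq hq'.
by rewrite /row_free mxrankMfree.
Qed.

(** A surjection onto a projective module has a section, so Q is the direct sum of P and Q' = ker e.
    The conclusion keeps what the induction on dimension consumes: projectivity, dimension, trace
    and Hom dimensions. *)
Lemma projective_split n p (rhoQ : A -> 'M[F]_n) (rhoP : A -> 'M[F]_p) e :
  is_rep rhoQ -> projective_mod rhoQ -> is_rep rhoP -> projective_mod rhoP ->
  is_hom rhoQ rhoP e -> row_free e ->
  exists n' (rhoQ' : A -> 'M[F]_n'),
   [/\ is_rep rhoQ', projective_mod rhoQ', n = (n' + p)%N,
       forall x, trm rhoQ x = trm rhoQ' x + trm rhoP x &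
       forall t (rhoT : A -> 'M[F]_t), is_rep rhoT ->
         \dim (homv rhoQ rhoT) = (\dim (homv rhoQ' rhoT) + \dim (homv rhoP rhoT))%N].
Proof.
move=> hQ pQ hP pP he fe.
have [t [ht et]] := pP _ _ _ _ _ _ hQ hP he fe (is_hom1 rhoP).
have [n' [rhoQ' [k [hQ' hk fk kk]]]] := sub_rep hQ (submod_ker he).
have ek : e *m k = 0.
  apply: trmx_inj; rewrite trmx_mul trmx0; apply/sub_kermxP.
  by rewrite -kk.
(* The idempotent 1 - t e has its image in ker e, which is the image of [k]; factoring it through
   [k] yields the retraction [r] onto Q'. *)
have [r kr] : exists r, k *m r = 1%:M - t *m e.
  have /submxP[D eD] : ((1%:M - t *m e)^T <= k^T)%MS.
    rewrite kk; apply/sub_kermxP; rewrite -trmx_mul mulmxBr mulmx1 mulmxA.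
    by rewrite et mul1mx subrr trmx0.
  by exists D^T; rewrite -[k]trmxK -trmx_mul -eD trmxK.
have rk : r *m k = 1%:M.
  apply: (row_full_inj fk); rewrite mulmxA kr mulmxBl mul1mx -mulmxA ek.
  by rewrite mulmx0 subr0 mulmx1.
have rt : r *m t = 0.
  apply: (row_full_inj fk); rewrite mulmxA kr mulmxBl mul1mx -mulmxA et.
  by rewrite mulmx1 subrr mulmx0.
have hrr : is_hom rhoQ rhoQ' r.
  move=> x; apply: (row_full_inj fk); rewrite !mulmxA -hk -mulmxA kr.
  by rewrite mulmxBr mulmxBl mulmx1 mul1mx mulmxA ht -!mulmxA he.
have tek : t *m e + k *m r = 1%:M by rewrite kr addrC subrK.
exists n', rhoQ'; split=> // [n1 n2 r1 r2 g f h1 h2 hg fg hf||x|w rhoT hT].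
- have [h [hh eh]] := pQ _ _ _ _ _ _ h1 h2 hg fg (is_hom_comp hrr hf).
  exists (h *m k); split; first exact: is_hom_comp hk hh.
  by rewrite mulmxA eh -mulmxA rk mulmx1.
- have := mxrank_ker e^T; rewrite -kk !mxrank_tr (eqP fk) (eqP fe) => ->.
  by rewrite subnK // -(eqP fe) rank_leq_col.
- rewrite /trm -[rhoQ x]mulmx1 -tek mulmxDr linearD /= addrC; congr (_ + _).
    by rewrite mulmxA hk -mulmxA mxtrace_mulC -mulmxA rk mulmx1.
  by rewrite mulmxA ht -mulmxA mxtrace_mulC -mulmxA et mulmx1.
(* [K] consists of the maps vanishing on the summand P. It is the kernel of restriction along [t],
   and restriction along [k] identifies it with Hom(Q', T). *)
pose K := (homv rhoQ rhoT :&: lker (linfun (mulmxr t)))%VS.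
have memK f : (f \in K) = (f \in homv rhoQ rhoT) && (f *m t == 0).
  by rewrite memv_cap memv_ker lfunE.
rewrite (dimv_exact (h := mulmxr t) (K := K) (V := homv rhoP rhoT)) => [|f|g|f].
- congr addn; transitivity (\dim (0 : {vspace 'M[F]_(w, n)})%VS
      + \dim (homv rhoQ' rhoT))%N; last by rewrite dimv0.
  apply: (dimv_exact (h := mulmxr k)) => [f|g|f].
  + rewrite memK => /andP[/(homvP _ hQ hT) hf _]; apply/homvP => //.
    exact: is_hom_comp hk hf.
  + move/(homvP _ hQ' hT) => hg; exists (g *m r); last first.
      by rewrite /= -mulmxA rk mulmx1.
    rewrite memK -mulmxA rt mulmx0 eqxx andbT; apply/homvP => //.
    exact: is_hom_comp hrr hg.
  rewrite memv0 memK /=; split=> [/eqP->|[/andP[_ /eqP ft] fk0]].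
    by rewrite mem0v !mul0mx eqxx.
  by rewrite -[f]mulmx1 -tek mulmxDr !mulmxA ft fk0 !mul0mx addr0.
- by move/(homvP _ hQ hT) => hf; apply/homvP => //; apply: is_hom_comp ht hf.
- move/(homvP _ hP hT) => hg; exists (g *m e).
    by apply/homvP => //; apply: is_hom_comp he hg.
  by rewrite /= -mulmxA et mulmx1.
by rewrite memK; split=> [/andP[-> /eqP]|[-> /= ->]].
Qed.

End Simple.

(** For an eigenvalue c of f, the endomorphism f - c is not invertible, while a nonzero endomorphism
    of a simple module is. *)
Lemma schur_scalar (F : closedFieldType) (A : falgType F) n (rho : A -> 'M[F]_n) f :
  simple_mod rho -> is_hom rho rho f -> exists c, f = c%:M.
Proof.
move=> sr hf; have [n0 _] := sr.
have : size (char_poly f) != 1%N by rewrite size_char_poly; case: n n0 {sr hf rho f}.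
case/closed_rootP=> c; rewrite -eigenvalue_root_char => ev; exists c.
have hc : is_hom rho rho (f - c%:M).
  by move=> x; rewrite mulmxBr mulmxBl hf scalar_mxC.
apply/eqP; rewrite -subr_eq0; apply: contraTT ev => fc.
by rewrite negbK kermx_eq0; apply: simple_epi hc sr fc.
Qed.

(** * Multiplicities and traces through Hom spaces of simples and their covers *)

Section Family.
Variables (F : closedFieldType) (A : falgType F) (m : nat).
Variables (s : 'I_m -> nat) (rhoS : forall i : 'I_m, A -> 'M[F]_(s i)).
Hypothesis hSrep : forall i, is_rep (rhoS i).
Hypothesis hSsimple : forall i, simple_mod (rhoS i).
Hypothesis hSdistinct : forall i j, mod_iso (rhoS i) (rhoS j) -> i = j.
Hypothesis hSall : forall n (rho : A -> 'M[F]_n), is_rep rho -> simple_mod rho ->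
  exists i, mod_iso rho (rhoS i).
Variables (p : 'I_m -> nat) (rhoP : forall i : 'I_m, A -> 'M[F]_(p i)).
Hypothesis hPrep : forall i, is_rep (rhoP i).
Hypothesis hPcov : forall i, proj_cover (rhoP i) (rhoS i).

(** A nonzero f : P_j -> S_k satisfies pi = g f for some g : S_k -> S_j, nonzero like pi, hence an
    isomorphism, which forces j = k. In that case g is a scalar and f lies on the line of pi. *)
Lemma dim_homv_cover j k : \dim (homv (rhoP j) (rhoS k)) = (j == k).
Proof.
have [_ [pi [hpi fpi ess]]] := hPcov j.
have pi0 : pi != 0.
  rewrite -mxrank_eq0 (eqP fpi) -lt0n.
  by case: (hSsimple j).
have fact f := proj_cover_factor (f := f) hpi (hSsimple j) ess (hSsimple k).
have [ejk|njk] := eqVneq j k.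
  subst k; transitivity (\dim <[pi]>%VS); last by rewrite dim_vline pi0.
  congr dimv; apply/vspaceP => f.
  apply/idP/vlineP => [/(homvP _ (hPrep j) (hSrep j)) hf|[c ->]]; last first.
    by rewrite memvZ //; apply/homvP.
  have [->|f0] := eqVneq f 0; first by exists 0; rewrite scale0r.
  have [g hg eg] := fact _ hf f0.
  have [c ec] := schur_scalar (hSsimple j) hg; exists c^-1.
  have c0 : c != 0.
    by apply: contraNneq pi0 => c0; rewrite eg ec c0 raddf0 mul0mx.
  by rewrite eg ec mul_scalar_mx scalerA mulVf // scale1r.
apply/eqP; rewrite dimv_eq0; apply/eqP/vspaceP => f; rewrite memv0.
apply/idP/eqP => [/(homvP _ (hPrep j) (hSrep k)) hf|->]; last exact: mem0v.
apply/eqP; apply: contraNT njk => f0.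
have [g hg eg] := fact _ hf f0.
have g0 : g != 0 by apply: contraNneq pi0 => g0; rewrite eg g0 mul0mx.
rewrite eq_sym; apply/eqP; apply: hSdistinct; exists g; split=> //.
  exact: simple_epi hg (hSsimple j) g0.
exact: simple_mono hg (hSsimple k) g0.
Qed.

(** Hom(P_j, -) grows by 1 at each factor isomorphic to S_j and by 0 at the others, whichever series
    witnesses the multiplicity. *)
Lemma comp_multE n (rho : A -> 'M[F]_n) j k :
  is_rep rho -> comp_mult rho (rhoS j) k -> k = \dim (homv (rhoP j) rho).
Proof.
move=> hr [r [U [lab [[U0 Ur hU ltU maxU] hlab ->]]]].
(* Extending the labels by [false] to all naturals allows induction over initial segments of the
   series. *)
pose lab' i := if insub i is Some i' then lab i' else false.
have Ue k' : (k' <= r)%N ->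
    \dim (homv_in (rhoP j) rho (U k')) = (\sum_(0 <= i < k') lab' i)%N.
  elim: k' => [_|k' IH ltk].
    rewrite big_geq //; apply/eqP; rewrite dimv_eq0; apply/eqP/vspaceP => f.
    rewrite memv0 mem_homv_in; apply/andP/eqP => [[_]|->]; last first.
      by rewrite mem0v trmx0 sub0mx.
    move/eqP: U0; rewrite mxrank_eq0 => /eqP->.
    by rewrite submx0 trmx_eq0 => /eqP.
  rewrite big_nat_recr //= -IH; last exact: ltnW.
  have lUU := ltU _ ltk; have sUU := ltmxW lUU.
  have step := dim_homv_in_step (hPrep j) (proj1 (hPcov j)) hr.
  rewrite /lab' insubT; case: (boolP (lab _)) => [/hlab /= sq|nl].
    by rewrite (step _ _ _ _ (hSrep j) (hU _ ltk) sUU sq) dim_homv_cover eqxx.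
  (* An unlabelled factor is simple by maximality, hence some S_i; here i = j would have forced the
     label. *)
  have [t [rhoQ [hQ sq]]] := subquot_exists hr (hU _ (ltnW ltk)) (hU _ ltk) sUU.
  have sQ := subquot_simple lUU (hU _ ltk) (maxU _ ltk) sq.
  have [i isoQ] := hSall hQ sQ; have sqi := subquot_iso_trans sq isoQ.
  rewrite (step _ _ _ _ (hSrep i) (hU _ ltk) sUU sqi) dim_homv_cover.
  case: eqVneq => // eji; subst i; case/negP: nl.
  by apply/hlab.
rewrite cardsE -sum1_card big_mkcond /=.
transitivity (\sum_(0 <= i < r) lab' i)%N.
  rewrite big_mkord; apply: eq_bigr => i _; rewrite /lab' valK unfold_in.
  by case: (lab i).
rewrite -Ue //; congr dimv; apply/vspaceP => f; rewrite mem_homv_in.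
by rewrite submx_full ?andbT // /row_full Ur.
Qed.

(** A nonzero Q maps onto some S_i. Projectivity of Q lifts this map to Q -> P_i, which turns out to
    be onto, so P_i splits off and the complement has smaller dimension. *)
Lemma trm_projective n (rhoQ : A -> 'M[F]_n) x :
  is_rep rhoQ -> projective_mod rhoQ ->
  trm rhoQ x = \sum_i (\dim (homv rhoQ (rhoS i)))%:R * trm (rhoP i) x.
Proof.
elim/ltn_ind: n => n IH in rhoQ *; move=> hQ pQ.
have [n0|n0] := posnP n.
  subst n; rewrite /trm /mxtrace big_ord0 big1 // => i _.
  suff -> : homv rhoQ (rhoS i) = 0%VS by rewrite dimv0 mul0r.
  apply/vspaceP => f; rewrite memv0; apply/idP/eqP => [_|->]; last exact: mem0v.
  by apply/matrixP=> a [].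
have [t [rhoT [q [hT sT hq fq]]]] := simple_quot hQ n0.
have [i [f [hf ff fu]]] := hSall hT sT.
have [pP [pi [hpi fpi ess]]] := hPcov i.
have hfq := is_hom_comp hq hf.
have [e [he ee]] := pQ _ _ _ _ _ _ (hPrep i) (hSrep i) hpi fpi hfq.
have fe : row_free e.
  rewrite -row_full_trmx -[e^T]mul1mx /row_full -mxrank_gen.
  apply: ess; first exact: submod_img he (submod1 _).
  apply: row_full_add_ker; rewrite /row_full (eqmxMr _ (genmxE _)) mul1mx.
  by rewrite -trmx_mul ee mxrank_tr mxrankMfree.
have [n' [rhoQ' [hQ' pQ' en trE dE]]] := projective_split hQ pQ (hPrep i) pP he fe.
have p0 : (0 < p i)%N.
  have [s0 _] := hSsimple i.
  by apply: leq_trans s0 _; rewrite -(eqP fpi) rank_leq_col.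
have ltn' : (n' < n)%N by rewrite en -[X in (X < _)%N]addn0 ltn_add2l.
rewrite trE (IH _ ltn' _ hQ' pQ').
transitivity (\sum_k ((\dim (homv rhoQ' (rhoS k)))%:R * trm (rhoP k) x
                      + (i == k)%:R * trm (rhoP k) x)).
  rewrite big_split /=; congr (_ + _); rewrite (bigD1 i) //= eqxx mul1r.
  by rewrite big1 ?addr0 // => k; rewrite eq_sym => /negPf->; rewrite mul0r.
by apply: eq_bigr => k _; rewrite dE // dim_homv_cover natrD mulrDl.
Qed.

End Family.

(** * The tensor-dual adjunction *)

Section Currying.
Variables (F : fieldType) (w p n : nat).
Implicit Types (f : 'M[F]_(w, p * n)) (g : 'M[F]_(w * n, p)) (b : 'I_n).

Definition curry_mx f : 'M[F]_(w * n, p) :=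
  \matrix_(i, j) f (mxtens_unindex i).1 (mxtens_index (j, (mxtens_unindex i).2)).

Definition uncurry_mx g : 'M[F]_(w, p * n) :=
  \matrix_(i, j) g (mxtens_index (i, (mxtens_unindex j).2)) (mxtens_unindex j).1.

Lemma curry_mxK : cancel curry_mx uncurry_mx.
Proof.
move=> f; apply/matrixP=> i j; case: (mxtens_indexP j) => c d.
by rewrite !mxE !mxtens_indexK.
Qed.

Lemma uncurry_mxK : cancel uncurry_mx curry_mx.
Proof.
move=> g; apply/matrixP=> i j; case: (mxtens_indexP i) => c d.
by rewrite !mxE !mxtens_indexK.
Qed.

Lemma curry_mx_is_linear : linear curry_mx.
Proof. by move=> c f g; apply/matrixP=> i j; rewrite !mxE. Qed.

HB.instance Definition _ := GRing.isLinear.Build F _ _ _ curry_mx curry_mx_is_linear.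

(** The map f(- (x) v_b) from P to W; [cslice g b] is the coefficient of g at v_b^*. Working slice
    by slice removes the tensor indices from the adjunction. *)
Definition slice f b : 'M[F]_(w, p) := \matrix_(i, j) f i (mxtens_index (j, b)).
Definition cslice g b : 'M[F]_(w, p) := \matrix_(i, j) g (mxtens_index (i, b)) j.

Lemma cslice_curry f b : cslice (curry_mx f) b = slice f b.
Proof. by apply/matrixP=> i j; rewrite !mxE mxtens_indexK. Qed.

Lemma slice_lin b : lin (slice^~ b).
Proof. by move=> c u v; apply/matrixP=> i j; rewrite !mxE. Qed.

Lemma cslice_lin b : lin (cslice^~ b).
Proof. by move=> c u v; apply/matrixP=> i j; rewrite !mxE. Qed.

Lemma slice_inj f1 f2 : (forall b, slice f1 b = slice f2 b) -> f1 = f2.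
Proof.
move=> e; apply/matrixP=> i j; case: (mxtens_indexP j) => c d.
by have /matrixP/(_ i c) := e d; rewrite !mxE.
Qed.

Lemma cslice_inj g1 g2 : (forall b, cslice g1 b = cslice g2 b) -> g1 = g2.
Proof.
move=> e; apply/matrixP=> i j; case: (mxtens_indexP i) => c d.
by have /matrixP/(_ c j) := e d; rewrite !mxE.
Qed.

Lemma slice_mull (B : 'M[F]_w) f b : slice (B *m f) b = B *m slice f b.
Proof.
by apply/matrixP=> i j; rewrite !mxE; apply: eq_bigr => k _; rewrite mxE.
Qed.

Lemma cslice_mulr (B : 'M[F]_p) g b : cslice (g *m B) b = cslice g b *m B.
Proof.
by apply/matrixP=> i j; rewrite !mxE; apply: eq_bigr => k _; rewrite mxE.
Qed.

Lemma sum_mxtens_index (a c : nat) (G : 'I_(a * c) -> F) :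
  \sum_k G k = \sum_i \sum_j G (mxtens_index (i, j)).
Proof.
rewrite pair_bigA /= (reindex (@mxtens_index a c)); last first.
  exists (@mxtens_unindex a c) => k _; first exact: mxtens_indexK.
  exact: mxtens_unindexK.
by apply: eq_bigr => -[].
Qed.

Lemma slice_mul_tens f (B : 'M[F]_p) (C : 'M[F]_n) b :
  slice (f *m tensmx B C) b = \sum_c C c b *: (slice f c *m B).
Proof.
apply/matrixP=> i j; rewrite !mxE sum_mxtens_index summxE exchange_big /=.
apply: eq_bigr => c _; rewrite !mxE mulr_sumr; apply: eq_bigr => k _.
by rewrite tensmxE mxE [RHS]mulrC -mulrA.
Qed.

Lemma cslice_tens_mul g (B : 'M[F]_w) (C : 'M[F]_n) b :
  cslice (tensmx B C *m g) b = \sum_c C b c *: (B *m cslice g c).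
Proof.
apply/matrixP=> i j; rewrite !mxE sum_mxtens_index summxE exchange_big /=.
apply: eq_bigr => c _; rewrite !mxE mulr_sumr; apply: eq_bigr => k _.
by rewrite tensmxE mxE mulrAC [RHS]mulrC.
Qed.

End Currying.

(** Naturality of currying in the target, which transports lifting problems across the
    adjunction. *)
Lemma curry_mx_mull (F : fieldType) w w' p n (B : 'M[F]_(w', w))
    (f : 'M[F]_(w, p * n)) :
  curry_mx (B *m f) = tensmx B 1%:M *m curry_mx f.
Proof.
apply/matrixP=> i j; case: (mxtens_indexP i) => c d.
rewrite !mxE !mxtens_indexK sum_mxtens_index; apply: eq_bigr => k _ /=.
rewrite (bigD1 d) //= big1 => [|l /negPf ld].
  by rewrite tensmxE !mxE mxtens_indexK eqxx mulr1 addr0.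
by rewrite tensmxE [1%:M _ _]mxE eq_sym ld mulr0 mul0r.
Qed.

Section Adjunction.
Variables (F : fieldType) (A : falgType F).
Variables (Delta : A -> 'M[F]_(hdim A)) (eps : A -> F) (S : A -> A).
Hypothesis hH : is_hopf Delta eps S.

Lemma sum_tsum (T : lmodType F) (I : finType) D (al : I -> F) (g : I -> A -> A -> T) :
  \sum_i al i *: tsum D (g i) = tsum D (fun u v => \sum_i al i *: g i u v).
Proof.
rewrite /tsum; under eq_bigr => i _ do rewrite scaler_sumr.
rewrite exchange_big; apply: eq_bigr => a _ /=.
under eq_bigr => i _ do rewrite scaler_sumr.
rewrite exchange_big; apply: eq_bigr => b _ /=.
by rewrite scaler_sumr; apply: eq_bigr => i _; rewrite !scalerA mulrC.
Qed.

(* Used with {R, T} = {rho, rho o S}: the two triangle identities of the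
   adjunction between - (x) V and tensoring with its dual. *)
Lemma convolution_cancel (E : lmodType F) n (R T : A -> 'M[F]_n)
    (Y : 'I_n -> A -> E) x b :
  (forall w, tsum (Delta w) (fun u v => R u *m T v) = eps w *: 1%:M) ->
  (forall d, lin (Y d)) ->
  tsum (Delta x) (fun u v => \sum_c T v c b *:
    tsum (Delta u) (fun a a' => \sum_d R a' d c *: Y d a)) = Y b x.
Proof.
move=> RT Yl.
transitivity (tsum (Delta x) (fun u v => tsum (Delta u) (fun a a' =>
    \sum_d (R a' *m T v) d b *: Y d a))).
  apply: eq_tsum => u v; rewrite sum_tsum; apply: eq_tsum => a a'.
  under eq_bigr => c _ do rewrite scaler_sumr.
  rewrite exchange_big; apply: eq_bigr => d _ /=.
  rewrite mxE scaler_suml; apply: eq_bigr => c _.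
  by rewrite scalerA mulrC.
rewrite (coassoc hH) -(counitr hH x (Yl b)); apply: eq_tsum => a w.
(* [L] pairs column [b] of a matrix with the family [Y]. Being linear, it passes through the
   convolution sum, and at the identity matrix it returns [Y b a]. *)
pose L (M : 'M[F]_n) := \sum_d M d b *: Y d a.
have Ll : lin L.
  move=> c M N; rewrite /L scaler_sumr -big_split; apply: eq_bigr => d _ /=.
  by rewrite !mxE scalerDl scalerA.
rewrite -[LHS](lin_tsum Ll) RT (linZ Ll) /L (bigD1 b) //= big1 => [|d /negPf db].
  by rewrite mxE eqxx scale1r addr0.
by rewrite mxE db scale0r.
Qed.

Variables (p w n : nat).
Variables (rhoP : A -> 'M[F]_p) (rhoW : A -> 'M[F]_w) (rhoV : A -> 'M[F]_n).
Hypotheses (hP : is_rep rhoP) (hW : is_rep rhoW) (hV : is_rep rhoV).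

Lemma is_hom_tens_slice f : is_hom (tens_rep Delta rhoP rhoV) rhoW f <->
  forall x b, rhoW x *m slice f b =
    tsum (Delta x) (fun u v => \sum_c rhoV v c b *: (slice f c *m rhoP u)).
Proof.
have E x b : slice (f *m tens_rep Delta rhoP rhoV x) b =
    tsum (Delta x) (fun u v => \sum_c rhoV v c b *: (slice f c *m rhoP u)).
  rewrite mulmx_tsumr (lin_tsum (slice_lin b)).
  by apply: eq_tsum => u v; rewrite slice_mul_tens.
split=> [hf x b|hf x]; first by rewrite -slice_mull hf E.
by apply: slice_inj => b; rewrite slice_mull hf E.
Qed.

Lemma is_hom_dual_slice f :
  is_hom rhoP (tens_rep Delta rhoW (dual_rep S rhoV)) (curry_mx f) <->
  forall x b, slice f b *m rhoP x =
    tsum (Delta x) (fun u v => \sum_c rhoV (S v) c b *: (rhoW u *m slice f c)).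
Proof.
have E x b : cslice (tens_rep Delta rhoW (dual_rep S rhoV) x *m curry_mx f) b =
    tsum (Delta x) (fun u v => \sum_c rhoV (S v) c b *: (rhoW u *m slice f c)).
  rewrite mulmx_tsuml (lin_tsum (cslice_lin b)).
  apply: eq_tsum => u v; rewrite cslice_tens_mul.
  by apply: eq_bigr => c _; rewrite mxE cslice_curry.
split=> [hf x b|hf x]; first by rewrite -E hf cslice_mulr cslice_curry.
by apply: cslice_inj => b; rewrite E cslice_mulr cslice_curry hf.
Qed.

(** The two conditions read x f(p (x) v) = sum f(x_(1) p (x) x_(2) v) and f(x p (x) v) = sum x_(1)
    f(p (x) S(x_(2)) v). Inserting the first into the right side of the second leaves x_(2) S(x_(3))
    acting on v; the converse leaves S(x_(2)) x_(3). Both collapse to the counit. *)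
Lemma is_hom_curry f : is_hom (tens_rep Delta rhoP rhoV) rhoW f <->
  is_hom rhoP (tens_rep Delta rhoW (dual_rep S rhoV)) (curry_mx f).
Proof.
have [Vl V1 VM] := hV; have [Pl _ _] := hP; have [Wl _ _] := hW.
apply: iff_trans (is_hom_tens_slice f) _.
apply: iff_trans (iff_sym (is_hom_dual_slice f)).
split=> hf x b.
- have Yl d : lin (fun u => slice f d *m rhoP u).
    by move=> c u v; rewrite Pl mulmxDr scalemxAr.
  rewrite -(convolution_cancel (R := rhoV) (T := rhoV \o S) x b _ Yl) => [|z].
    apply: eq_tsum => u v; apply: eq_bigr => c _.
    by rewrite hf.
  rewrite -V1 -(antipoder hH z Vl).
  by apply: eq_tsum => u v; rewrite VM.
have Yl d : lin (fun u => rhoW u *m slice f d).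
  by move=> c u v; rewrite Wl mulmxDl scalemxAl.
rewrite -(convolution_cancel (R := rhoV \o S) (T := rhoV) x b _ Yl) => [|z].
  apply: eq_tsum => u v; apply: eq_bigr => c _.
  by rewrite hf.
rewrite -V1 -(antipodel hH z Vl).
by apply: eq_tsum => u v; rewrite VM.
Qed.

Lemma dim_homv_curry :
  \dim (homv (tens_rep Delta rhoP rhoV) rhoW)
  = \dim (homv rhoP (tens_rep Delta rhoW (dual_rep S rhoV))).
Proof.
have hPV := tens_rep_is_rep hH hP hV.
have hWV := tens_rep_is_rep hH hW (dual_rep_is_rep hH hV).
transitivity (\dim (0 : {vspace 'M[F]_(w, p * n)})%VS +
  \dim (homv rhoP (tens_rep Delta rhoW (dual_rep S rhoV))))%N; last by rewrite dimv0.
apply: (dimv_exact (h := @curry_mx F w p n)) => [f|g|f].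
- by move/(homvP _ hPV hW) => hf; apply/homvP => //; apply/is_hom_curry.
- move/(homvP _ hP hWV) => hg; exists (uncurry_mx g); last exact: uncurry_mxK.
  by apply/homvP => //; apply/is_hom_curry; rewrite uncurry_mxK.
rewrite memv0; split=> [/eqP->|[_ f0]]; first by rewrite mem0v linear0.
by apply/eqP; apply: (can_inj (@curry_mxK F w p n)); rewrite f0 linear0.
Qed.

End Adjunction.

(** * Functoriality of the tensor product and projectivity of P (x) V *)

Section Tensor.
Variables (F : fieldType) (A : falgType F).
Variables (Delta : A -> 'M[F]_(hdim A)) (eps : A -> F) (S : A -> A).
Hypothesis hH : is_hopf Delta eps S.

Lemma is_hom_tens n1 n1' n2 n2' (r1 : A -> 'M[F]_n1) (r1' : A -> 'M[F]_n1')
    (r2 : A -> 'M[F]_n2) (r2' : A -> 'M[F]_n2') f1 f2 :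
  is_hom r1 r1' f1 -> is_hom r2 r2' f2 ->
  is_hom (tens_rep Delta r1 r2) (tens_rep Delta r1' r2') (tensmx f1 f2).
Proof.
move=> h1 h2 x; rewrite mulmx_tsuml mulmx_tsumr; apply: eq_tsum => u v.
by rewrite !tensmx_mul h1 h2.
Qed.

Lemma row_free_tens m1 n1 m2 n2 (f1 : 'M[F]_(m1, n1)) (f2 : 'M[F]_(m2, n2)) :
  row_free f1 -> row_free f2 -> row_free (tensmx f1 f2).
Proof.
move=> /row_freeP[B1 e1] /row_freeP[B2 e2]; apply/row_freeP.
by exists (tensmx B1 B2); rewrite tensmx_mul e1 e2 tensmx11.
Qed.

Lemma row_full_tens m1 n1 m2 n2 (f1 : 'M[F]_(m1, n1)) (f2 : 'M[F]_(m2, n2)) :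
  row_full f1 -> row_full f2 -> row_full (tensmx f1 f2).
Proof. by rewrite -!row_free_trmx trmx_tens; apply: row_free_tens. Qed.

Lemma mod_iso_tensr n1 n2 n2' (r1 : A -> 'M[F]_n1) (r2 : A -> 'M[F]_n2)
    (r2' : A -> 'M[F]_n2') :
  mod_iso r2 r2' -> mod_iso (tens_rep Delta r1 r2) (tens_rep Delta r1 r2').
Proof.
have f1 : row_free (1%:M : 'M[F]_n1) by rewrite /row_free mxrank1.
move=> [f [hf fr fl]]; exists (tensmx 1%:M f); split.
- exact: is_hom_tens (is_hom1 r1) hf.
- exact: row_free_tens.
exact: row_full_tens.
Qed.

Lemma dim_homv_iso n n1 n2 (r : A -> 'M[F]_n) (r1 : A -> 'M[F]_n1)
    (r2 : A -> 'M[F]_n2) :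
  is_rep r -> is_rep r1 -> is_rep r2 -> mod_iso r1 r2 ->
  \dim (homv r r1) = \dim (homv r r2).
Proof.
move=> hr h1 h2 [f [hf fr fl]].
have [B fB] := row_freeP fr.
have Bf : B *m f = 1%:M.
  by apply: (row_full_inj fl); rewrite mulmxA fB mul1mx mulmx1.
have hB : is_hom r2 r1 B.
  move=> x; apply: (row_full_inj fl).
  by rewrite !mulmxA -hf -mulmxA fB mulmx1 mul1mx.
transitivity (\dim (0 : {vspace 'M[F]_(n1, n)})%VS + \dim (homv r r2))%N; last first.
  by rewrite dimv0.
apply: (dimv_exact (h := mulmx f)) => [g|g|g].
- by move/(homvP _ hr h1) => hg; apply/homvP => //; apply: is_hom_comp hg hf.
- move/(homvP _ hr h2) => hg; exists (B *m g); last by rewrite /= mulmxA fB mul1mx.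
  by apply/homvP => //; apply: is_hom_comp hg hB.
rewrite memv0; split=> [/eqP->|[_ /= fg]]; first by rewrite mem0v /= mulmx0.
by rewrite -[g]mul1mx -Bf -mulmxA fg mulmx0.
Qed.

(** Currying turns lifting f along g into lifting [curry_mx f] along g (x) id, still onto, from P,
    where projectivity applies. *)
Lemma projective_tens p n (rhoP : A -> 'M[F]_p) (rhoV : A -> 'M[F]_n) :
  is_rep rhoP -> is_rep rhoV -> projective_mod rhoP ->
  projective_mod (tens_rep Delta rhoP rhoV).
Proof.
move=> hP hV pP n1 n2 r1 r2 g f h1 h2 hg fg hf.
have hVd := dual_rep_is_rep hH hV.
have f1 : row_free (1%:M : 'M[F]_n) by rewrite /row_free mxrank1.
have [h [hh eh]] := pP _ _ _ _ _ _ (tens_rep_is_rep hH h1 hVd)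
  (tens_rep_is_rep hH h2 hVd) (is_hom_tens hg (is_hom1 _)) (row_free_tens fg f1)
  (proj1 (is_hom_curry hH hP h2 hV f) hf).
exists (uncurry_mx h); split.
  by apply/(is_hom_curry hH hP h1 hV); rewrite uncurry_mxK.
by apply: (can_inj (@curry_mxK _ _ _ _)); rewrite curry_mx_mull uncurry_mxK.
Qed.

End Tensor.

(** Letting W be any module isomorphic to the dual of V covers both identities: W is the dual itself
    in one, and V as dual of its dual in the other. *)
Lemma TrP_McKay (F : closedFieldType) (A : falgType F)
  (Delta : A -> 'M[F]_(hdim A)) (eps : A -> F) (S : A -> A)
  (hH : is_hopf Delta eps S)
  (m : nat) (s : 'I_m -> nat) (rhoS : forall i : 'I_m, A -> 'M[F]_(s i))
  (hSrep : forall i, is_rep (rhoS i))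
  (hSsimple : forall i, simple_mod (rhoS i))
  (hSdistinct : forall i j, mod_iso (rhoS i) (rhoS j) -> i = j)
  (hSall : forall n (rho : A -> 'M[F]_n), is_rep rho -> simple_mod rho ->
             exists i, mod_iso rho (rhoS i))
  (p : 'I_m -> nat) (rhoP : forall i : 'I_m, A -> 'M[F]_(p i))
  (hPrep : forall i, is_rep (rhoP i))
  (hPcov : forall i, proj_cover (rhoP i) (rhoS i))
  (n k : nat) (rhoV : A -> 'M[F]_n) (rhoW : A -> 'M[F]_k)
  (hV : is_rep rhoV) (hW : is_rep rhoW) (M : 'M[nat]_m) (x : A) :
  mod_iso (dual_rep S rhoV) rhoW -> is_McKay Delta rhoS rhoW M ->
  TrP rhoP x *m natmx F M
  = tsum (Delta x) (fun u v => trm rhoV v *: TrP rhoP u).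
Proof.
move=> isoW hM; apply/rowP => j.
have hPV := tens_rep_is_rep hH (hPrep j) hV.
have pPV := projective_tens hH (hPrep j) hV (proj1 (hPcov j)).
transitivity (trm (tens_rep Delta (rhoP j) rhoV) x).
  rewrite (trm_projective hSrep hSsimple hSdistinct hSall hPrep hPcov x hPV pPV).
  rewrite mxE; apply: eq_bigr => i _; rewrite !mxE mulrC.
  rewrite (dim_homv_curry hH (hPrep j) (hSrep i) hV).
  have hSW := tens_rep_is_rep hH (hSrep i) hW.
  have hSV := tens_rep_is_rep hH (hSrep i) (dual_rep_is_rep hH hV).
  rewrite (dim_homv_iso (hPrep j) hSV hSW (mod_iso_tensr Delta (rhoS i) isoW)).
  by rewrite -(comp_multE hSrep hSsimple hSdistinct hSall hPrep hPcov hSW (hM i j)).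
rewrite /trm /tens_rep /tsum raddf_sum summxE; apply: eq_bigr => a _.
rewrite raddf_sum summxE; apply: eq_bigr => b _ /=.
by rewrite mxtraceZ mxtrace_tens !mxE mulrCA mulrC -mulrA [_ * \tr _]mulrC.
Qed.

Theorem mainTheorem6
  (F : closedFieldType) (A : falgType F)
  (Delta : A -> 'M[F]_(hdim A)) (eps : A -> F) (S : A -> A)
  (hH : is_hopf Delta eps S)
  (* S_1, ..., S_m : the simple modules up to isomorphism *)
  (m : nat) (s : 'I_m -> nat) (rhoS : forall i : 'I_m, A -> 'M[F]_(s i))
  (hSrep : forall i, is_rep (rhoS i))
  (hSsimple : forall i, simple_mod (rhoS i))
  (hSdistinct : forall i j, mod_iso (rhoS i) (rhoS j) -> i = j)
  (hSall : forall n (rho : A -> 'M[F]_n), is_rep rho -> simple_mod rho ->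
             exists i, mod_iso rho (rhoS i))
  (* P_1, ..., P_m : their projective covers *)
  (p : 'I_m -> nat) (rhoP : forall i : 'I_m, A -> 'M[F]_(p i))
  (hPrep : forall i, is_rep (rhoP i))
  (hPcov : forall i, proj_cover (rhoP i) (rhoS i))
  (* V : a finite-dimensional module, with McKay matrices M_V and M_{V^*} *)
  (n : nat) (rhoV : A -> 'M[F]_n) (hVrep : is_rep rhoV)
  (MV MVd : 'M[nat]_m)
  (hMV : is_McKay Delta rhoS rhoV MV)
  (hMVd : is_McKay Delta rhoS (dual_rep S rhoV) MVd) :
  (forall x : A,
     TrP rhoP x *m natmx F MVd
     = tsum (Delta x) (fun u v => trm rhoV v *: TrP rhoP u))
  /\
  (mod_iso (dual_rep S (dual_rep S rhoV)) rhoV ->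
     [/\ (forall x : A,
            TrP rhoP x *m natmx F MV
            = tsum (Delta x) (fun u v => trm (dual_rep S rhoV) v *: TrP rhoP u)),
         (forall g : A, g != 0 -> Delta g = tcoord g g ->
            TrP rhoP g *m natmx F MV = trm (dual_rep S rhoV) g *: TrP rhoP g) &
         (forall x y z : A, y != 0 -> z != 0 ->
            Delta x = tcoord x y + tcoord z x ->
            TrP rhoP x *m natmx F MV
            = trm (dual_rep S rhoV) y *: TrP rhoP x
              + trm (dual_rep S rhoV) x *: TrP rhoP z)]).
Proof.
have hVd := dual_rep_is_rep hH hVrep.
have main := TrP_McKay hH hSrep hSsimple hSdistinct hSall hPrep hPcov.
split=> [x|iso].
  apply: (main _ _ _ _ hVrep hVd) => //.
  by exists 1%:M; rewrite /row_free /row_full mxrank1; split=> //; apply: is_hom1.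
(* The dual of V now takes the place of V, and V that of its dual, by the assumed isomorphism. *)
have E x := main _ _ _ _ hVd hVrep _ x iso hMV.
have L1 w : lin (fun u => trm (dual_rep S rhoV) w *: TrP rhoP u).
  move=> c u v; apply/rowP=> i; rewrite !mxE /trm.
  by have [l _ _] := hPrep i; rewrite l mxtraceD mxtraceZ mulrDr mulrCA.
have L2 w : lin (fun v => trm (dual_rep S rhoV) v *: TrP rhoP w).
  move=> c u v; rewrite /trm; have [l _ _] := hVd.
  by rewrite l mxtraceD mxtraceZ scalerDl scalerA.
split=> // [g _ Dg|x y z _ _ Dx].
  by rewrite E Dg tsum_tcoord.
by rewrite E Dx (linD (tsum_lin _)) !tsum_tcoord.
Qed.
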